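(* For every positive integer $N$, the map $\Phi_N$ is a bijection from $\mathcal{OP}_N$ (the partitions into odd parts at most $2N$) onto $\mathcal{L}_N$ (the lecture hall partitions of width $N$).
   Context: A partition is a finite weakly decreasing sequence $\lambda=(\lambda_1\ge\lambda_2\ge\dots\ge\lambda_\ell>0)$ of positive integers (the empty partition $\emptyset$ is allowed); $\ell(\lambda)=\ell$ is its length. Partitions are identified with sequences obtained by appending zeros. Finitely supported integer sequences are added and subtracted entrywise ($+$, $-$). $\lambda\sqcup\mu$ is the partition whose multiset of parts is the union (multiplicities added) of those of $\lambda$ and $\mu$. Lecture hall partitions. For a positive integer $N$, $\mathcal{L}_N$ is the set of partitions $\mu$ with $\ell(\mu)\le N$ and $$\frac{\mu_1}{N}\ge\frac{\mu_2}{N-1}\ge\dots\ge\frac{\mu_{\ell(\mu)}}{N-\ell(\mu)+1}$$ ($\emptyset\in\mathcal{L}_N$). $\mathcal{OP}_N$ is the set of partitions all of whose parts are odd and at most $2N$ (so parts lie in $\{1,3,\dots,2N-1\}$). Trapezoids. For $n\ge k\ge1$, $[\Diamond]_{n,k}=(n,n-1,\dots,n-2k+2)$ if $k\le n/2$ and $[\Diamond]_{n,k}=(n,n-1,\dots,2k-n-1)$ if $k>n/2$ (a trailing $0$ is dropped); $[\Diamond]_{k-1,k}=\emptyset$. For $i,k\ge1$ put $A_{i,k}=[\Diamond]_{k+i-1,k}-[\Diamond]_{k+i-2,k}$, an integer sequence. The map $\Phi_N$ and the counter $I$. For $\lambda\in\mathcal{OP}_N$ an integer sequence $\Phi_N(\lambda)$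 and a counter $I(\lambda)=[I_1(\lambda),\dots,I_N(\lambda)]$ of nonnegative integers are defined recursively by inserting the parts of $\lambda$ in weakly decreasing order. Start: $\Phi_N(\emptyset)=\emptyset$, $I(\emptyset)=[0,\dots,0]$. Step: if $2k-1$ ($1\le k\le N$) is at most every part of $\lambda$, let $i(\lambda)=\min\{j: I_j(\lambda)=0\}$; then $\Phi_N(\lambda\sqcup(2k-1))=\Phi_N(\lambda)+A_{i(\lambda),k}$, and $I(\lambda\sqcup(2k-1))$ is obtained from $I(\lambda)$ by decreasing each $I_j(\lambda)$ with $j<i(\lambda)$ by $1$, setting the $i(\lambda)$-th entry equal to $N-k-i(\lambda)+1$, and leaving the entries with $j>i(\lambda)$ unchanged. *)

(* Defs.v *)
(* Mathematical Components, with the sets of mathcomp-classical. *)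
From HB Require Import structures.
From mathcomp Require Import all_boot all_order all_algebra zify.
From mathcomp Require Import boolp classical_sets functions.

Set Implicit Arguments.
Unset Strict Implicit.
Unset Printing Implicit Defensive.

Import Order.TTheory GRing.Theory Num.Theory.
Local Open Scope classical_set_scope.
Local Open Scope ring_scope.

Definition is_partition (la : seq nat) : bool :=
  sorted geq la && all (leq 1) la.

(* Identifies a sequence with the integer sequence obtained by appending zeros;
   the first entry gets index 0. *)
Definition pad (s : seq nat) : nat -> int := fun j => (nth 0%N s j)%:Z.

(* Indices start at 0, so the inequality below is
   mu_(i+1) / (N - i) >= mu_(i+2) / (N - i - 1); the subtractions are not
   truncated since i.+1 < size mu <= N. *)
Definition lecture_hall (N : nat) : set (seq nat) :=
  [set mu | [/\ is_partition mu, (size mu <= N)%N &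
    forall i, (i.+1 < size mu)%N ->
      (nth 0%N mu i)%:R / (N - i)%:R >= (nth 0%N mu i.+1)%:R / (N - i.+1)%:R
        :> rat]].

Definition odd_partitions (N : nat) : set (seq nat) :=
  [set la | is_partition la && all (fun p => odd p && (p <= 2 * N)%N) la].

(* (n, n-1, ..., n-2k+2) has 2k-1 entries and (n, n-1, ..., 2k-n-1) has
   2n-2k+2 entries.  For n = k-1 the latter is empty, as it should be.  A
   trailing 0 is kept here; it disappears under [pad]. *)
Definition trapezoid (n k : nat) : seq nat :=
  mkseq (fun j => n - j)%N
    (if (2 * k <= n)%N then (2 * k - 1)%N else (2 * n + 2 - 2 * k)%N).

(* Meant for i, k >= 1. *)
Definition A (i k : nat) : nat -> int := fun j =>
  pad (trapezoid (k + i - 1) k) j - pad (trapezoid (k + i - 2) k) j.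

(* A counter [I_1, ..., I_N] is a sequence of size N, I_j being its entry of
   index j-1.  This is min {j : I_j = 0}, or N+1 if there is no such j; the
   latter does not happen below, by [counter_wf]. *)
Definition first_zero (I : seq nat) : nat := (index 0%N I).+1.

(* The subtractions are never truncated: I_j > 0 for j < i by minimality of i,
   and see [counter_wf] for N - k - i + 1. *)
Definition counter_step (N k : nat) (I : seq nat) : seq nat :=
  mkseq (fun j0 => let j := j0.+1 in
    if (j < first_zero I)%N then (nth 0%N I j0 - 1)%N
    else if j == first_zero I then (N + 1 - k - first_zero I)%N
    else nth 0%N I j0) N.

(* k such that p = 2k-1, for p odd. *)
Definition odd_index (p : nat) : nat := p./2.+1.

Definition insert_part (N : nat) (st : (nat -> int) * seq nat) (p : nat) :
    (nat -> int) * seq nat :=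
  let k := odd_index p in
  (fun j => st.1 j + A (first_zero st.2) k j, counter_step N k st.2).

(* The list la is weakly decreasing, so that its parts are inserted from the
   largest to the smallest; see [Phi_rcons] and [counter_rcons]. *)
Definition Phi_state (N : nat) (la : seq nat) : (nat -> int) * seq nat :=
  foldl (insert_part N) (pad [::], nseq N 0%N) la.

Definition Phi (N : nat) (la : seq nat) : nat -> int := (Phi_state N la).1.

Definition counter (N : nat) (la : seq nat) : seq nat := (Phi_state N la).2.

Lemma Phi_rcons (N k : nat) (la : seq nat) : (0 < k)%N ->
  Phi N (rcons la (2 * k - 1)%N) =
    fun j => Phi N la j + A (first_zero (counter N la)) k j.
Proof.
move=> k0; have e : odd_index (2 * k - 1) = k by rewrite /odd_index; lia.
by rewrite /Phi /Phi_state -cats1 foldl_cat /= e.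
Qed.

Lemma counter_rcons (N k : nat) (la : seq nat) : (0 < k)%N ->
  counter N (rcons la (2 * k - 1)%N) = counter_step N k (counter N la).
Proof.
move=> k0; have e : odd_index (2 * k - 1) = k by rewrite /odd_index; lia.
by rewrite /counter /Phi_state -cats1 foldl_cat /= e.
Qed.

Lemma first_zero_le (I : seq nat) (j : nat) :
  nth 0%N I j = 0%N -> (first_zero I <= j.+1)%N.
Proof.
rewrite /first_zero ltnS leqNgt => Ij; apply/negP => lt_j.
by have := before_find 0%N lt_j; rewrite /= Ij eqxx.
Qed.

Lemma counter_bound (N : nat) (la : seq nat) (k : nat) :
    odd_partitions N la -> all (leq (2 * k - 1)) la ->
  (0 < k)%N -> size (counter N la) = N /\
  forall j, (nth 0%N (counter N la) j <= N - k - j)%N.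
Proof.
elim/last_ind: la k => [|la p IH] k.
  move=> _ _ _; rewrite /counter /= size_nseq; split=> // j.
  by rewrite nth_nseq; case: ifP.
have geq_trans : transitive geq.
  by move=> a b c; rewrite /= => h1 h2; exact: leq_trans h2 h1.
rewrite /odd_partitions /is_partition /= !all_rcons.
case/andP => /andP[srt /andP[_ pos]] /andP[/andP[op leN] al] /andP[kp _] k0.
move: srt; rewrite -cats1 (sorted_pairwise geq_trans) pairwise_cat allrel1r.
case/and3P => ge_p srt _.
have ep : p = (2 * odd_index p - 1)%N by rewrite /odd_index; lia.
have [] := IH (odd_index p) _ _ isT.
- rewrite /odd_partitions /is_partition /= (sorted_pairwise geq_trans) srt al.
  by rewrite pos.
- by rewrite -ep.
rewrite cats1 [in counter N (rcons _ _)]ep counter_rcons //.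
move: (odd_index p) ep => m ep.
move: (counter N la) => I sI bI.
split; first by rewrite size_mkseq.
move=> j; have [jN|Nj] := ltnP j N; last first.
  by rewrite nth_default // size_mkseq.
by rewrite nth_mkseq //=; have := bI j; case: ifP => ?; last (case: eqP => ?); lia.
Qed.

(* The recursion is well defined: at each step there is a j with I_j = 0, and
   the new entry N - k - i + 1 is nonnegative. *)
Lemma counter_wf (N k : nat) (la : seq nat) :
    odd_partitions N la -> (1 <= k <= N)%N -> all (leq (2 * k - 1)) la ->
  [/\ size (counter N la) = N, 0%N \in counter N la &
      (k + first_zero (counter N la) <= N + 1)%N].
Proof.
move=> oN /andP[k0 kN] al; have [sI bI] := counter_bound oN al k0.
have z : nth 0%N (counter N la) (N - k) = 0%N.
  by have := bI (N - k)%N; rewrite subnn leqn0 => /eqP.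
split=> //; last by have := first_zero_le z; lia.
by rewrite -z mem_nth // sI; lia.
Qed.

(* Main.v *)
Require Import Defs.
From mathcomp Require Import all_boot all_order all_algebra zify.
From mathcomp Require Import boolp classical_sets functions.

Set Implicit Arguments.
Unset Strict Implicit.
Unset Printing Implicit Defensive.

Import Order.TTheory GRing.Theory Num.Theory.
Local Open Scope classical_set_scope.
Local Open Scope ring_scope.

(** Group the insertions into rows: row t (0 <= t < N) inserts the part 2k-1
with k = N-t, say m t times.  Let I t j be the counter entry I_(j+1) before
row t, and R t j the number of insertions in row t with i > j, so that
R t 0 = m t.  An insertion lowers I_(j+1) by 1 if i > j+1 and raises it from 0
to t-j if i = j+1; hence, for j <= t,
    I t j + (t-j) R t j = I (t+1) j + (t+1-j) R t (j+1),
with I t j < t-j (or I t t = 0) and I (t+1) j < t+1-j.  So each cell (t, j) just rewrites a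
natural number from radix t-j to radix t+1-j, which is a bijection as long as
j < t.

Numbering entries from 0 and setting j = L/2 rounded down, mu = Phi_N(lambda)
satisfies mu_L = (N-L) x_L - u_L, where u_L < N-L is the counter entry I_(j+1)
right after the last row that affects mu_L, and x_L is the number of insertions
with i = j+1 up to that row.  In these coordinates (x_L is the ceiling of
mu_L / (N-L)) the lecture hall inequality reads x_L >= x_(L+1) + [u_L > u_(L+1)].
The difference x_(2j) - x_(2j+1) is R t j - R t (j+1) for t = N-1-j, and x_(2j+1) - x_(2j+2) = [u_(2j+1) > u_(2j+2)] + R j j.
So (u, x) fixes the entry R t (min (N-1-t) t) of every row; running the cells
backwards from there, from the last row to the first, recovers m, and conversely
any admissible (u, x) can be fed into this procedure. *)

(** * Sorted lists and the entries of the sequences A_{i,k} *)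

Lemma sorted_geq_cat_nseq la s p : sorted geq la -> all (leq p) la ->
  sorted geq (la ++ nseq s p).
Proof.
have geq_trans : transitive geq by move=> a b c /= h1 h2; exact: leq_trans h2 h1.
move=> srt al.
rewrite (sorted_pairwise geq_trans) pairwise_cat -!(sorted_pairwise geq_trans).
rewrite srt /=; apply/andP; split; last first.
  by case: s => // n /=; elim: n => //= n ->; rewrite leqnn.
by apply/allrelP => x y /(allP al) h /nseqP[-> _].
Qed.

(** Passing from n = k+i-2 to n+1 raises each entry of the trapezoid by 1 and appends the entries of
    index 2i-2 and 2i-1, the length being capped at 2k-1; the cap L < 2k-1 is [uphalf L < k]. *)
Lemma A_entry (i k L : nat) : (0 < i)%N -> (0 < k)%N ->
  A i k L = if (uphalf L < k)%N then
      (if (L./2.+1 < i)%N then 1 else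
       if L./2.+1 == i then (k - uphalf L)%N%:Z else 0)
    else 0.
Proof.
move=> i0 k0; rewrite /A /pad /trapezoid.
have n_mk f n : nth 0%N (mkseq f n) L = if (L < n)%N then f L else 0%N.
  by case: ltnP => h; [rewrite nth_mkseq | rewrite nth_default ?size_mkseq].
rewrite !n_mk.
have := uphalf_half L; have := odd_double_half L; move: (uphalf L) (L./2) => a h.
case: (odd L) => /= eL ->; case: (leqP (2 * k) _) => c1; case: (leqP (2 * k) _) => c2;
  do ?case: ifP; lia.
Qed.

(** * Insertion in rows of equal parts *)

Definition row_parts (N : nat) (m : nat -> nat) (t : nat) : seq nat :=
  flatten [seq nseq (m s) (2 * (N - s) - 1)%N | s <- iota 0 t].

(** Here s ranges freely, so that inductions inside a row can run on s; s = m t completes the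
    row. *)
Definition in_row (N : nat) (m : nat -> nat) (t s : nat) : seq nat :=
  row_parts N m t ++ nseq s (2 * (N - t) - 1)%N.

Lemma row_partsS N m t : row_parts N m t.+1 = in_row N m t (m t).
Proof. by rewrite /row_parts -[t.+1]addn1 iotaD map_cat flatten_cat /= cats0. Qed.

Lemma row_parts_mem N m t x : x \in row_parts N m t ->
  exists2 s, (s < t)%N & x = (2 * (N - s) - 1)%N.
Proof.
move=> /flattenP[r /mapP[s]]; rewrite mem_iota => st -> /nseqP[-> _].
by exists s => //; lia.
Qed.

Lemma in_row_ge N m t s : all (leq (2 * (N - t) - 1)) (in_row N m t s).
Proof.
rewrite all_cat all_nseq leqnn orbT andbT.
by apply/allP => x /row_parts_mem[r rt ->]; lia.
Qed.

Lemma row_parts_sorted N m t : sorted geq (row_parts N m t).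
Proof.
elim: t => // t IH; rewrite row_partsS sorted_geq_cat_nseq //.
by have := in_row_ge N m t 0; rewrite /in_row cats0.
Qed.

Lemma in_row_odd N m t s : (t < N)%N -> odd_partitions N (in_row N m t s).
Proof.
move=> tN; rewrite /odd_partitions /is_partition /=.
have := in_row_ge N m t s; rewrite all_cat => /andP[al _].
rewrite sorted_geq_cat_nseq ?row_parts_sorted //= -all_predI.
apply/allP => x; rewrite mem_cat => /orP[/row_parts_mem[r rt ->]|/nseqP[-> _]] /=; lia.
Qed.

Lemma in_rowS N m t s : in_row N m t s.+1 = rcons (in_row N m t s) (2 * (N - t) - 1)%N.
Proof. by rewrite /in_row -[s.+1]addn1 nseqD catA cats1. Qed.

Lemma in_row0 N m t : in_row N m t 0 = row_parts N m t.
Proof. exact: cats0. Qed.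

Definition cnt N m t s j : nat := nth 0%N (counter N (in_row N m t s)) j.
Definition act N m t s : nat := first_zero (counter N (in_row N m t s)).

Lemma cnt_bound N m t s j : (t < N)%N -> (cnt N m t s j <= t - j)%N.
Proof.
move=> tN.
have [_ /(_ j)] := counter_bound (in_row_odd m s tN) (in_row_ge N m t s) ltac:(lia).
rewrite -/(cnt _ _ _ _ _); lia.
Qed.

Lemma act_bound N m t s : (t < N)%N -> (act N m t s <= t.+1)%N.
Proof.
move=> tN; have k0 : (1 <= N - t <= N)%N by lia.
have [_ _] := counter_wf (in_row_odd m s tN) k0 (in_row_ge N m t s).
rewrite -/(act _ _ _ _); lia.
Qed.

Lemma act_gt0 N m t s : (0 < act N m t s)%N. Proof. by []. Qed.

Lemma cnt_act N m t s j : (t < N)%N -> (j.+1 <= act N m t s)%N ->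
  (cnt N m t s j == 0%N) = (j.+1 == act N m t s).
Proof.
move=> tN; have k0 : (1 <= N - t <= N)%N by lia.
have [_ zI _] := counter_wf (in_row_odd m s tN) k0 (in_row_ge N m t s).
rewrite /act /cnt /first_zero ltnS eqSS leq_eqVlt => /orP[/eqP->|lt_j].
  by rewrite nth_index // !eqxx.
by rewrite (ltn_eqF lt_j); exact: (before_find 0%N lt_j).
Qed.

Lemma cntS N m t s j : (t < N)%N ->
  cnt N m t s.+1 j = if (j.+1 < act N m t s)%N then (cnt N m t s j - 1)%N else
    if j.+1 == act N m t s then (t - j)%N else cnt N m t s j.
Proof.
move=> tN; rewrite {1}/cnt in_rowS counter_rcons; last lia.
have [jN|Nj] := ltnP j N; last first.
  rewrite nth_default ?size_mkseq //; have := act_bound m s tN.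
  have := cnt_bound m s j tN; case: ifP; last case: ifP; lia.
rewrite nth_mkseq //= -/(act _ _ _ _) -/(cnt _ _ _ _ _).
case: ifP => // _; case: eqP => // <-; lia.
Qed.

Lemma PhiS N m t s L : (t < N)%N ->
  Phi N (in_row N m t s.+1) L = Phi N (in_row N m t s) L + A (act N m t s) (N - t) L.
Proof. by move=> tN; rewrite in_rowS Phi_rcons //; lia. Qed.

(** * Conservation law of a row and the coordinates (u, x) *)

Definition flow N m t s j : nat := \sum_(r < s) (j < act N m t r)%N.

Lemma flowS N m t s j : flow N m t s.+1 j = (flow N m t s j + (j < act N m t s)%N)%N.
Proof. by rewrite /flow big_ord_recr. Qed.

Lemma flow0 N m t s : flow N m t s 0 = s.
Proof. by rewrite /flow (eq_bigr (fun=> 1%N)) // sum1_card card_ord. Qed.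

Lemma flow_eq0 N m t s j : (t < N)%N -> (t < j)%N -> flow N m t s j = 0%N.
Proof.
move=> tN tj; rewrite /flow big1 // => r _; have := act_bound m r tN; lia.
Qed.

Lemma cell_in_row N m t s j : (t < N)%N -> (j <= t)%N ->
  (cnt N m t 0 j + (t - j) * flow N m t s j =
   cnt N m t s j + (t.+1 - j) * flow N m t s j.+1)%N.
Proof.
move=> tN jt; elim: s => [|s IH]; first by rewrite /flow !big_ord0 !muln0.
rewrite !flowS cntS //; have := cnt_bound m s j tN.
have := @cnt_act N m t s j tN.
have -> : (t.+1 - j)%N = (t - j).+1 by lia.
move: IH; have -> : (t.+1 - j)%N = (t - j).+1 by lia.
move: (t - j)%N (flow _ _ _ _ j) (flow _ _ _ _ j.+1) => K R R' IH.
(* With K = t-j, an insertion with i > j+1 adds K to the left side and (K+1) - 1 to the right; one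
   with i = j+1 adds K to both, as the counter entry goes from 0 to K; one with i < j+1 changes
   nothing. *)
by case: (ltngtP j.+1 (act N m t s)) => h /=; nia.
Qed.

(** An insertion with i > L/2+1 adds 1 to entry L and takes 1 from I_(L/2+1); one with i = L/2+1
    adds N-t-[uphalf L] to the entry and t-L/2 to the counter, N-L in all. From row N-[uphalf L] on,
    entry L stays fixed. *)
Lemma Phi_in_row N m t s L : (t < N)%N ->
  Phi N (in_row N m t s) L =
    if (t < N - uphalf L)%N then
      Phi N (row_parts N m t) L + (cnt N m t 0 L./2)%:Z - (cnt N m t s L./2)%:Z
      + (N - L)%N%:Z * ((flow N m t s L./2)%:Z - (flow N m t s L./2.+1)%:Z)
    else Phi N (row_parts N m t) L.
Proof.
move=> tN; elim: s => [|s IH].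
  rewrite in_row0 /flow !big_ord0; case: ifP => // _; lia.
rewrite PhiS // IH A_entry ?act_gt0 ?subn_gt0 //.
have := uphalf_half L; have := odd_double_half L => oL uL.
case: ifP => tL; last by case: ifP; lia.
have -> : (uphalf L < N - t)%N by lia.
rewrite cntS // !flowS; have := cnt_bound m s L./2 tN.
have := @cnt_act N m t s L./2 tN; have := act_bound m s tN.
have [y ey] : exists y, (N - L)%N = y by eexists.
by rewrite ey; case: (ltngtP L./2.+1 (act N m t s)) => h /=; nia.
Qed.

(* Only the cells with t + j < N influence Phi_N. *)
Definition cell_array (N : nat) (I R : nat -> nat -> nat) : Prop :=
  [/\ forall t j, (t + j <= N)%N -> (I t j <= t.-1 - j)%N,
      forall t j, (t + j <= N)%N -> (t < j)%N -> R t j = 0%N &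
      forall t j, (j <= t)%N -> (t + j < N)%N ->
        (I t j + (t - j) * R t j = I t.+1 j + (t.+1 - j) * R t j.+1)%N].

(** The u_L of the overview, read just before row N-[uphalf L], the first that no longer affects
    entry L; [ratio_ceil] is x_L. *)
Definition defect (N : nat) (I : nat -> nat -> nat) (L : nat) : nat :=
  I (N - uphalf L)%N L./2.

Definition ratio_ceil (N : nat) (R : nat -> nat -> nat) (L : nat) : int :=
  \sum_(t < N - uphalf L) ((R t L./2)%:Z - (R t L./2.+1)%:Z).

Definition row_cnt N m t j : nat := nth 0%N (counter N (row_parts N m t)) j.
Definition row_flow N m t j : nat := flow N m t (m t) j.

Lemma row_cnt0 N m j : row_cnt N m 0 j = 0%N.
Proof. by rewrite /row_cnt /row_parts /counter /= nth_nseq; case: ifP. Qed.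

Lemma row_cell_array N m : cell_array N (row_cnt N m) (row_flow N m).
Proof.
split=> [[|t] j tj|t j tj lt_tj|t j jt tj]; first by rewrite row_cnt0.
- by rewrite /row_cnt row_partsS; apply: cnt_bound; lia.
- by apply: flow_eq0; lia.
- rewrite /row_cnt row_partsS -[in LHS]in_row0; apply: cell_in_row; lia.
Qed.

Lemma Phi_row_parts N m L :
  Phi N (row_parts N m N) L = (N - L)%N%:Z * ratio_ceil N (row_flow N m) L
    - (defect N (row_cnt N m) L)%:Z.
Proof.
rewrite /ratio_ceil /defect.
suff H T : (T <= N)%N -> Phi N (row_parts N m T) L =
    (N - L)%N%:Z * \sum_(t < minn T (N - uphalf L))
      ((row_flow N m t L./2)%:Z - (row_flow N m t L./2.+1)%:Z)
    - (row_cnt N m (minn T (N - uphalf L)) L./2)%:Z.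
  by rewrite H // (minn_idPr _) // leq_subr.
elim: T => [_|T IH TN].
  by rewrite min0n big_ord0 row_cnt0 mulr0 /Phi /= /pad nth_nil.
rewrite row_partsS Phi_in_row // IH; last exact: ltnW.
case: ltnP => hT.
  have -> : minn T.+1 (N - uphalf L) = T.+1 by lia.
  rewrite big_ord_recr /= [in RHS]mulrDr /cnt in_row0 -row_partsS -/(row_cnt N m T _).
  by rewrite -/(row_cnt N m T.+1 _) /row_flow subrK addrAC.
by have -> : minn T.+1 (N - uphalf L) = (N - uphalf L)%N by lia.
Qed.

(** * Forward determination: column 0 of the flow determines the array *)

Lemma mixed_radix_uniq (K i r i' r' : nat) : (i < K)%N -> (i' < K)%N ->
  (i + K * r = i' + K * r')%N -> i = i' /\ r = r'.
Proof.
move=> iK i'K e; have rr' : r = r' by nia.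
by split=> //; move: e; rewrite rr'; lia.
Qed.

(** Within row t, I t j and R t j give R t (j+1) and I (t+1) j as quotient and remainder by t+1-j;
    rows are run upwards in t. *)
Lemma cell_array_forward N I R I' R' :
  cell_array N I R -> cell_array N I' R' ->
  (forall t, (t < N)%N -> R t 0%N = R' t 0%N) ->
  (forall t j, (t + j <= N)%N -> I t j = I' t j) /\
  (forall t j, (t < N)%N -> (t + j <= N)%N -> R t j = R' t j).
Proof.
move=> [bI zR cell] [bI' zR' cell'] R0.
have row t : (t < N)%N -> (forall j, (t + j <= N)%N -> I t j = I' t j) ->
    forall j, (t + j <= N)%N -> R t j = R' t j /\
      ((t + j < N)%N -> I t.+1 j = I' t.+1 j).
  move=> tN It; have step j : (t + j < N)%N -> R t j = R' t j ->
      R t j.+1 = R' t j.+1 /\ I t.+1 j = I' t.+1 j.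
    (* Beyond the diagonal there is no cell equation, but the bounds force both values to be 0. *)
    move=> tjN Rj; have [jt|tj] := leqP j t; last first.
      have := bI t.+1 j; have := bI' t.+1 j; rewrite zR ?zR'; lia.
    have := cell _ _ jt tjN; rewrite It ?Rj ?(cell' _ _ jt tjN); last lia.
    have := bI t.+1 j; have := bI' t.+1 j.
    move=> b1 b2 e; have [||? ?] := mixed_radix_uniq _ _ e; lia.
  have RR j : (t + j <= N)%N -> R t j = R' t j.
    elim: j => [_|j IH tj]; first exact: R0.
    by case: (step j) => //; [lia|apply: IH; lia].
  by move=> j tj; split; [exact: RR|move=> h; case: (step j h (RR j tj))].
have II t : forall j, (t + j <= N)%N -> I t j = I' t j.
  elim: t => [|t IH] j tj; first by have := bI _ _ tj; have := bI' _ _ tj; lia.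
  have tN : (t < N)%N by lia.
  by have [_ ->] := row t tN IH j ltac:(lia); last lia.
by split=> // t j tN tj; have [] := row t tN (II t) j tj.
Qed.

(** * Differences of the x_L, and boundary values *)

(** The sum for x_(2j) has one more row, t = N-1-j, in the same two columns. *)
Lemma ratio_ceil_even N R j : (2 * j < N)%N ->
  ratio_ceil N R (2 * j) = ratio_ceil N R (2 * j).+1 +
    ((R (N - j.+1)%N j)%:Z - (R (N - j.+1)%N j.+1)%:Z).
Proof.
move=> jN; rewrite /ratio_ceil.
have -> : uphalf (2 * j) = j by lia.
have -> : uphalf (2 * j).+1 = j.+1 by lia.
have -> : (2 * j)./2 = j by lia.
have -> : (2 * j).+1./2 = j by lia.
have -> : (N - j)%N = (N - j.+1).+1 by lia.
by rewrite big_ord_recr.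
Qed.

Lemma ratio_ceil_odd N I R j : cell_array N I R -> ((2 * j).+1 < N)%N ->
  ratio_ceil N R (2 * j).+1 = ratio_ceil N R (2 * j).+2 +
    (defect N I (2 * j).+2 < defect N I (2 * j).+1)%N%:Z + (R j j)%:Z.
Proof.
move=> [bI zR cell] jN; rewrite /ratio_ceil /defect.
have -> : uphalf (2 * j).+1 = j.+1 by lia.
have -> : uphalf (2 * j).+2 = j.+1 by lia.
have -> : (2 * j).+1./2 = j by lia.
have -> : (2 * j).+2./2 = j.+1 by lia.
(* The two sums run over the same rows but in adjacent columns; they are compared row by row, and
   the row T = j contributes R j j. *)
suff H T : (T + j < N)%N ->
    \sum_(t < T) ((R t j)%:Z - (R t j.+1)%:Z) =
    \sum_(t < T) ((R t j.+1)%:Z - (R t j.+2)%:Z) + (I T j.+1 < I T j)%N%:Z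
    + (if (j < T)%N then R j j else 0%N)%:Z.
  rewrite H; last lia.
  by have -> : (j < N - j.+1)%N by lia.
elim: T => [|T IH] TN.
  rewrite !big_ord0 /= addr0.
  by have := bI 0%N j ltac:(lia); rewrite leqn0 => /eqP ->.
rewrite !big_ord_recr /= IH; last lia.
have b1 := bI T j ltac:(lia); have b2 := bI T j.+1 ltac:(lia).
have b3 := bI T.+1 j ltac:(lia); have b4 := bI T.+1 j.+1 ltac:(lia).
rewrite /= in b3 b4.
case: (ltngtP j T) => [jT|Tj|eT].
- have -> : (j < T.+1)%N by lia.
  have := cell T j (ltnW jT) ltac:(lia); have := cell T j.+1 jT ltac:(lia).
  have -> : (T.+1 - j)%N = (T - j).+1 by lia.
  have -> : (T.+1 - j.+1)%N = (T - j)%N by lia.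
  have eK : (T - j)%N = (T - j.+1).+1 by lia.
  move: b1 b2 b3 b4; rewrite eK.
  have -> : (T.-1 - j)%N = (T - j.+1)%N by lia.
  have leK : (T.-1 - j.+1 <= T - j.+1)%N by lia.
  move: (T - j.+1)%N (T.-1 - j.+1)%N eK leK => K K' eK leK.
  set S := \sum_(i < T) _; move: S => S.
  move: (I T j) (I T j.+1) (I T.+1 j) (I T.+1 j.+1) (R T j) (R T j.+1) (R T j.+2).
  move=> a b a' b' r r' r'' h1 h2 h3 h4 e2 e1.
  have bK : (b <= K)%N by lia.
  (* Adding the two cell equations gives (K+1)(r - 2r' + r'') = (a'-b') - (a-b); the bounds on the
     counters then force r - 2r' + r'' = [b' < a'] - [b < a]. *)
  have : (K.+1 * (r + r'') + a + b' = a' + b + K.+1 * (r' + r'))%N by lia.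
  case: (ltnP b a) => ab; case: (ltnP b' a') => ab'; nia.
- have I0 : I T j = 0%N by lia.
  have I1 : I T.+1 j = 0%N by lia.
  have -> : (j < T.+1)%N = false by lia.
  rewrite I0 I1 (zR T j) ?(zR T j.+1) ?(zR T j.+2); try lia.
  by rewrite !subrr !addr0.
- subst T; have I0 : I j j = 0%N by lia.
  have I1 : I j.+1 j = 0%N by lia.
  rewrite I0 I1 (zR j j.+1) ?(zR j j.+2) ?ltnSn; try lia.
  by rewrite !subrr !subr0.
Qed.

Lemma even_odd_cases (P : nat -> Prop) :
  (forall j, P (2 * j)%N) -> (forall j, P (2 * j).+1) -> forall L, P L.
Proof.
move=> Pe Po L; rewrite -(odd_double_half L) -mul2n.
by case: (odd L); rewrite ?add1n ?add0n.
Qed.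

(** In the rows t < N-[uphalf N] both columns lie beyond the diagonal, where the flow vanishes. The
    values at L = N serve as the end of the chain of x_L. *)
Lemma ratio_ceil_width N I R : cell_array N I R -> ratio_ceil N R N = 0.
Proof.
move=> [_ zR _]; rewrite /ratio_ceil big1 // => t _.
have := ltn_ord t; have := odd_double_half N; have := uphalf_half N.
by move=> *; rewrite !zR ?subrr; lia.
Qed.

Lemma defect_width N I R : cell_array N I R -> defect N I N = 0%N.
Proof.
move=> [bI _ _]; rewrite /defect.
have := odd_double_half N; have := uphalf_half N => e1 e2.
by have := bI (N - uphalf N)%N N./2 ltac:(lia); lia.
Qed.

Lemma defect_lt N I R L : cell_array N I R -> (L < N)%N ->
  (defect N I L < N - L)%N.
Proof.
move=> [bI _ _]; rewrite /defect.
have := odd_double_half L; have := uphalf_half L => e1 e2 LN.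
by have := bI (N - uphalf L)%N L./2 ltac:(lia); lia.
Qed.

Lemma cell_array_boundary N I R t j : cell_array N I R ->
  (t + j = N)%N \/ (t + j.+1 = N)%N ->
  I t j = defect N I (2 * j + (t + j < N)%N)%N \/ (t <= j)%N /\ I t j = 0%N.
Proof.
move=> [bI _ _] tj; have [jt|jt] := leqP t j.
  by right; split=> //; have := bI t j; case: tj => ?; lia.
left; rewrite /defect; congr (I _ _); case: tj => tj; lia.
Qed.

(** * Backward determination: (u, x) determine the array *)

(** The u_L fix the counter on the diagonals t+j = N and t+j+1 = N, and the x_L fix one flow per
    row. From there, rows are run downwards in t and columns leftwards, I t j and R t j being
    remainder and quotient by t-j. *)
Lemma cell_array_backward N I R I' R' :
  cell_array N I R -> cell_array N I' R' ->
  (forall L, (L < N)%N -> defect N I L = defect N I' L) ->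
  (forall L, (L < N)%N -> ratio_ceil N R L = ratio_ceil N R' L) ->
  forall t, (t < N)%N -> R t 0%N = R' t 0%N.
Proof.
move=> arr arr' eqd eqx.
have bdry t j : (t + j = N)%N \/ (t + j.+1 = N)%N -> I t j = I' t j.
  move=> tj; have [bI _ _] := arr; have [bI' _ _] := arr'.
  have [e|[h ->]] := cell_array_boundary arr tj; last first.
    have := bI' t j; case: tj; lia.
  have [e'|[h ->]] := cell_array_boundary arr' tj; last first.
    have := bI t j; case: tj; lia.
  have [LN|LN] := ltnP (2 * j + (t + j < N)) N; first by rewrite e e' eqd.
  by have := bI t j; have := bI' t j; case: tj; lia.
have {}eqd L : (L <= N)%N -> defect N I L = defect N I' L.
  rewrite leq_eqVlt => /orP[/eqP->|]; last exact: eqd.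
  by rewrite (defect_width arr) (defect_width arr').
have {}eqx L : (L <= N)%N -> ratio_ceil N R L = ratio_ceil N R' L.
  rewrite leq_eqVlt => /orP[/eqP->|]; last exact: eqx.
  by rewrite (ratio_ceil_width arr) (ratio_ceil_width arr').
have [bI zR cell] := arr; have [bI' zR' cell'] := arr'.
have row t : (t < N)%N -> (forall j, (t.+1 + j <= N)%N -> I t.+1 j = I' t.+1 j) ->
    forall j, (j <= t)%N -> (t + j < N)%N -> R t j = R' t j /\ I t j = I' t j.
  move=> tN It.
  (* If t < N-1-t, the difference x_(2t+1) - x_(2t+2) exhibits R t t. Otherwise, at j = N-1-t, the
     cell equation and x_(2j) - x_(2j+1) are two independent linear equations for R t j and R t
     (j+1). *)
  have start : R t (minn (N - t.+1) t) = R' t (minn (N - t.+1) t).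
    have [h|h] := leqP (N - t.+1) t; last first.
      have := ratio_ceil_odd arr (j := t) ltac:(lia).
      have := ratio_ceil_odd arr' (j := t) ltac:(lia).
      rewrite !eqx ?eqd; lia.
    have := @ratio_ceil_even N R (N - t.+1) ltac:(lia).
    have := @ratio_ceil_even N R' (N - t.+1) ltac:(lia).
    rewrite !eqx; try lia.
    have -> : (N - (N - t.+1).+1)%N = t by lia.
    have := cell t (N - t.+1)%N h ltac:(lia).
    have := cell' t (N - t.+1)%N h ltac:(lia).
    rewrite It ?(bdry t); try lia.
    have -> : (t.+1 - (N - t.+1))%N = (t - (N - t.+1)).+1 by lia.
    by move: (t - _)%N (R _ _) (R _ _) (R' _ _) (R' _ _) => K a b a' b'; nia.
  suff H d j : (d + j)%N = minn (N - t.+1) t -> R t j = R' t j /\ I t j = I' t j.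
    by move=> j jt tj; apply: (H (minn (N - t.+1) t - j)%N); lia.
  elim: d j => [|d IH] j dj.
    rewrite -dj add0n in start; split=> //.
    have [h|h] := leqP t j; first by have := bI t j; have := bI' t j; lia.
    by apply: bdry; lia.
  have [Rj _] := IH j.+1 ltac:(lia).
  have := cell t j ltac:(lia) ltac:(lia).
  rewrite It ?Rj -?cell'; try lia.
  have := bI t j ltac:(lia); have := bI' t j ltac:(lia) => b b' e.
  by have [] := mixed_radix_uniq _ _ e; lia.
have II d t : (d + t)%N = N -> forall j, (t + j <= N)%N -> I t j = I' t j.
  elim: d t => [|d IH] t dt j tj; first by apply: bdry; lia.
  have [jt|jt] := leqP t j; first by have := bI t j; have := bI' t j; lia.
  have [e|ne] := eqVneq (t + j)%N N; first by apply: bdry; left.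
  by have [] := row t ltac:(lia) (IH t.+1 ltac:(lia)) j; lia.
move=> t tN; have [] // := row t tN _ 0%N; last lia.
by apply: (II (N - t.+1)%N); lia.
Qed.

(** * Construction of an array from (u, x) *)

Section BackwardConstruction.
Variables (N : nat) (u : nat -> nat) (x : nat -> int).

(** For t < N, the last column j with a cell in row t, that is, with j <= t and t+j < N. *)
Definition last_col (t : nat) : nat := minn (N - t.+1) t.

(* The values R t j and R t (j+1) at j = [last_col t].  If N-1-t <= t they solve
   u_(2j+1) + (N-2j-1) R = u_(2j) + (N-2j) R' and R - R' = x_(2j) - x_(2j+1);
   the absolute values are those of nonnegative numbers. *)
Definition start_flow (t : nat) : nat :=
  let j := last_col t in
  absz (if (N - t.+1 <= t)%N then
      (N - 2 * j)%N%:Z * (x (2 * j)%N - x (2 * j).+1) + (u (2 * j).+1)%:Z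
        - (u (2 * j)%N)%:Z
    else x (2 * j).+1 - x (2 * j).+2 - (u (2 * j).+2 < u (2 * j).+1)%N%:Z)%R.

Definition exit_flow (t : nat) : nat :=
  let j := last_col t in
  if (N - t.+1 <= t)%N then
    absz ((N - (2 * j).+1)%N%:Z * (x (2 * j)%N - x (2 * j).+1) + (u (2 * j).+1)%:Z
        - (u (2 * j)%N)%:Z)%R
  else 0%N.

(* The flow at column [last_col t - d], given the counter v after row t. *)
Fixpoint back_flow_rec (t : nat) (v : nat -> nat) (d : nat) : nat :=
  if d is d'.+1 then
    let j := (last_col t - d)%N in
    ((v j + (t.+1 - j) * back_flow_rec t v d') %/ (t - j))%N
  else start_flow t.

Definition back_flow (t : nat) (v : nat -> nat) (j : nat) : nat :=
  if (j <= last_col t)%N then back_flow_rec t v (last_col t - j)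
  else if j == (last_col t).+1 then exit_flow t else 0%N.

(* [u] only fixes the counter on these two diagonals; the other entries come from
   the cells. *)
Definition boundary_cnt (t j : nat) : nat :=
  if (t + j == N)%N then u (2 * j)%N
  else if (t + j.+1 == N)%N then u (2 * j).+1 else 0%N.

(** Indexed by d = N-t, so that running from the last row to the first is a structural recursion. *)
Fixpoint back_cnt_rec (d : nat) : nat -> nat :=
  let t := (N - d)%N in
  if d is d'.+1 then fun j =>
    if (j < last_col t)%N then
      ((back_cnt_rec d' j + (t.+1 - j) * back_flow t (back_cnt_rec d') j.+1)
         %% (t - j))%N
    else boundary_cnt t j
  else boundary_cnt t.

Definition back_cnt (t : nat) : nat -> nat := back_cnt_rec (N - t).
Definition back_R (t : nat) : nat -> nat := back_flow t (back_cnt t.+1).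

(** Left of [last_col t], this and [back_RE] present the counter and the flow as remainder and
    quotient of one number by t-j. *)
Lemma back_cntE t j : (t <= N)%N -> back_cnt t j =
  if (t < N)%N && (j < last_col t)%N then
    ((back_cnt t.+1 j + (t.+1 - j) * back_R t j.+1) %% (t - j))%N
  else boundary_cnt t j.
Proof.
move=> tN; rewrite /back_R /back_cnt; have [tN'|NT] := ltnP t N.
  have -> : (N - t)%N = (N - t.+1).+1 by lia.
  by rewrite /= (_ : N - (N - t.+1).+1 = t)%N //; lia.
have -> : t = N by lia.
by rewrite subnn /= subn0.
Qed.

Lemma back_RE t j : (j < last_col t)%N -> back_R t j =
  ((back_cnt t.+1 j + (t.+1 - j) * back_R t j.+1) %/ (t - j))%N.
Proof.
move=> jt; rewrite {1}/back_R /back_flow ltnW //.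
have e : (last_col t - j)%N = (last_col t - j.+1).+1 by lia.
rewrite e /= -e subKn; last exact: ltnW.
by rewrite /back_R /back_flow jt.
Qed.

Lemma back_R_start t : back_R t (last_col t) = start_flow t.
Proof. by rewrite /back_R /back_flow leqnn subnn. Qed.

Lemma back_R_exit t : back_R t (last_col t).+1 = exit_flow t.
Proof. by rewrite /back_R /back_flow ltnn eqxx. Qed.

(** * Correctness of the construction for admissible (u, x) *)

Hypothesis u_lt : forall L, (L < N)%N -> (u L < N - L)%N.
Hypothesis u_out : forall L, (N <= L)%N -> u L = 0%N.
Hypothesis x_step : forall L, (L < N)%N ->
  x L.+1 + (u L.+1 < u L)%N%:Z <= x L.

Lemma back_cnt_bound t j : (t + j <= N)%N -> (back_cnt t j <= t.-1 - j)%N.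
Proof.
move=> tj; rewrite back_cntE; last lia.
case: ifP => [/andP[tN jt]|c].
  have h : (0 < t - j)%N by rewrite /last_col in jt; lia.
  have := ltn_pmod (back_cnt t.+1 j + (t.+1 - j) * back_R t j.+1) h; lia.
rewrite /boundary_cnt /last_col in c *; case: eqP => [e|ne].
  have [h|h] := ltnP (2 * j) N; first by have := u_lt h; lia.
  by rewrite u_out.
case: eqP => [e|ne2] //.
have [h|h] := ltnP (2 * j).+1 N; first by have := u_lt h; lia.
by rewrite u_out.
Qed.

(** With K = N-2j-1 and d = x_(2j) - x_(2j+1), the system has the solution exit = K d + u_(2j+1) -
    u_(2j) and start = exit + d. *)
Lemma back_exit_start t (j := last_col t) : (t < N)%N -> (N - t.+1 <= t)%N ->
  ((u (2 * j).+1 + (N - (2 * j).+1) * start_flow t =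
    u (2 * j) + (N - 2 * j) * exit_flow t)%N) /\
  (start_flow t)%:Z - (exit_flow t)%:Z = x (2 * j)%N - x (2 * j).+1.
Proof.
move=> tN h; rewrite /start_flow /exit_flow h -/j.
have jN : (2 * j < N)%N by rewrite /j /last_col; lia.
have := x_step jN; have := u_lt jN.
have u1 : (u (2 * j).+1 <= N - (2 * j).+1)%N.
  have [h1|h1] := ltnP (2 * j).+1 N; first by have := u_lt h1; lia.
  by rewrite u_out.
have [K eK] : exists K, (N - (2 * j).+1)%N = K by eexists.
have -> : (N - 2 * j)%N = K.+1 by lia.
rewrite !{}eK in u1 *.
move: (u (2 * j)%N) (u (2 * j).+1) u1 => a b bK aK xs.
have [d ed] : exists d : nat, x (2 * j)%N - x (2 * j).+1 = d%:Z.
  by exists (absz (x (2 * j)%N - x (2 * j).+1)); lia.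
rewrite ed.
(* The absolute values in the definitions change nothing: admissibility gives a <= b, or d >= 1
   together with a <= K. *)
have nonneg : (a <= b + K * d)%N.
  have {xs ed} : (0 < d)%N \/ (a <= b)%N by lia.
  by case=> h2; nia.
by move: nonneg; nia.
Qed.

Lemma back_cell_array : cell_array N back_cnt back_R.
Proof.
split; first exact: back_cnt_bound.
  move=> t j tj lt_tj; rewrite /back_R /back_flow.
  have -> : (j <= last_col t)%N = false by rewrite /last_col; lia.
  case: eqP => // ej; rewrite /exit_flow; case: ifP => // h.
  (* Beyond the diagonal only the exit column is in question; there N - (2j+1) = 0 for j =
     [last_col t] and both values of u vanish. *)
  have e : (N = (2 * last_col t).+1)%N by rewrite /last_col in ej *; lia.
  have u0 : u (2 * last_col t)%N = 0%N.
    by have := u_lt (L := (2 * last_col t)%N) ltac:(lia); lia.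
  by rewrite u0 -!e u_out // subnn mul0r.
move=> t j jt tj; have [jl|lj] := ltnP j (last_col t).
  rewrite back_cntE ?(back_RE jl); last lia.
  rewrite jl (_ : t < N)%N; last lia.
  by rewrite addnC mulnC -divn_eq.
have bnd : back_cnt t j = boundary_cnt t j.
  by rewrite back_cntE ?(ltnNge j) ?lj ?andbF //; lia.
(* At j = [last_col t]: if j = t < N-1-t, every term of the cell equation is 0; otherwise the
   equation is the one that [start_flow] and [exit_flow] solve. *)
have [h|h] := leqP (N - t.+1) t; last first.
  have ej : j = t by rewrite /last_col in lj; lia.
  have el : last_col t = t by rewrite /last_col; lia.
  have := back_R_exit t; rewrite el /exit_flow leqNgt h /= ej => ->.
  have := back_cnt_bound (t := t) (j := t) ltac:(lia).
  have := back_cnt_bound (t := t.+1) (j := t) ltac:(lia); lia.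
have ej : j = last_col t by rewrite /last_col in lj *; lia.
have [e _] := back_exit_start (t := t) ltac:(lia) h.
rewrite bnd back_cntE; last lia.
have -> : (j < last_col t.+1)%N = false by rewrite /last_col in ej *; lia.
rewrite andbF /boundary_cnt.
have -> : (t + j == N)%N = false by lia.
have -> : (t + j.+1 == N)%N by rewrite /last_col in ej; lia.
have -> : (t.+1 + j == N)%N by rewrite /last_col in ej; lia.
have -> : back_R t j = start_flow t by rewrite ej back_R_start.
have -> : back_R t j.+1 = exit_flow t by rewrite ej back_R_exit.
move: e; rewrite -ej.
have -> : (t - j)%N = (N - (2 * j).+1)%N by rewrite /last_col in ej; lia.
by have -> : (t.+1 - j)%N = (N - 2 * j)%N by rewrite /last_col in ej; lia.
Qed.

Lemma back_defect L : (L < N)%N -> defect N back_cnt L = u L.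
Proof.
move: L; apply: even_odd_cases => j LN; rewrite /defect back_cntE ?leq_subr //.
  have -> : uphalf (2 * j) = j by lia.
  have -> : (2 * j)./2 = j by lia.
  rewrite /last_col /boundary_cnt.
  have -> : (j < minn (N - (N - j).+1) (N - j))%N = false by lia.
  by rewrite andbF subnK ?eqxx //; lia.
have -> : uphalf (2 * j).+1 = j.+1 by lia.
have -> : (2 * j).+1./2 = j by lia.
rewrite /last_col /boundary_cnt.
have -> : (j < minn (N - (N - j.+1).+1) (N - j.+1))%N = false by lia.
have -> : (N - j.+1 + j == N)%N = false by lia.
by rewrite andbF subnK ?eqxx //; lia.
Qed.

Hypothesis x_out : x N = 0.

(** Descending induction from x_N = 0: [start_flow] and [exit_flow] were chosen to give the
    differences x_L - x_(L+1). *)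
Lemma back_ratio_ceil L : (L <= N)%N -> ratio_ceil N back_R L = x L.
Proof.
move=> LN; have [d] : exists d, (d + L = N)%N by exists (N - L)%N; lia.
elim: d L LN => [|d IH] L LN dL.
  by rewrite (_ : L = N) ?(ratio_ceil_width back_cell_array).
move: (IH L.+1 ltac:(lia) ltac:(lia)) => {IH}.
have {}dL : (L < N)%N by lia.
have xs := x_step dL.
move: L dL xs {LN}; apply: even_odd_cases => j LN xs e.
  rewrite ratio_ceil_even // e.
  have ej : last_col (N - j.+1) = j by rewrite /last_col; lia.
  have [_] := back_exit_start (t := (N - j.+1)%N) ltac:(lia) ltac:(lia).
  by rewrite -back_R_start -back_R_exit ej => ->; lia.
have [h|h] := ltnP (2 * j).+1 N; last lia.
rewrite (ratio_ceil_odd back_cell_array) // e.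
have ej : last_col j = j by rewrite /last_col; lia.
have -> : defect N back_cnt (2 * j).+2 = u (2 * j).+2.
  have [h2|h2] := ltnP (2 * j).+2 N; first exact: back_defect.
  by rewrite u_out // (_ : (2 * j).+2 = N) ?(defect_width back_cell_array) //; lia.
have := back_R_start j; rewrite ej => ->.
rewrite back_defect // /start_flow ej.
have -> : (N - j.+1 <= j)%N = false by lia.
lia.
Qed.

End BackwardConstruction.

(** * Odd partitions as rows, and the lecture hall inequality in the coordinates *)

Lemma row_parts_odd N m T : (T <= N)%N -> odd_partitions N (row_parts N m T).
Proof. by case: T => // T TN; rewrite row_partsS; exact: in_row_odd. Qed.

Lemma count_row_parts N m T t : (T <= N)%N -> (t < N)%N ->
  count_mem (2 * (N - t) - 1)%N (row_parts N m T) = if (t < T)%N then m t else 0%N.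
Proof.
move=> TN tN; elim: T TN => [|T IH] TN //.
rewrite row_partsS /in_row count_cat count_nseq IH /=; last exact: ltnW.
by case: eqP => e; case: (ltngtP t T) => tT; do ?case: ifP; try (subst t); lia.
Qed.

Lemma odd_partition_rows N la : odd_partitions N la ->
  la = row_parts N (fun t => count_mem (2 * (N - t) - 1)%N la) N.
Proof.
have geq_trans : transitive geq by move=> a b c /= h1 h2; exact: leq_trans h2 h1.
have geq_anti : antisymmetric geq by move=> a b /=; lia.
move=> /andP[/andP[srt _] /allP odd_la].
apply: (sorted_eq geq_trans geq_anti) => //; first exact: row_parts_sorted.
apply/allP => x; rewrite mem_cat => x_in.
have [t tN ->] : exists2 t, (t < N)%N & x = (2 * (N - t) - 1)%N.
  case/orP: x_in => [/odd_la /andP[ox xN]|/row_parts_mem //].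
  (* x = 2k-1 with k = [x./2.+1], and row t holds the parts with k = N-t. *)
  by exists (N - x./2.+1)%N; lia.
by rewrite /= count_row_parts // tN.
Qed.

(* With K = N-L-1: the lecture hall inequality between the entries L and L+1. *)
Lemma lecture_hall_step (K a a' : nat) (x x' : int) : (0 < K)%N ->
  (a <= K)%N -> (a' < K)%N ->
  (K.+1%:Z * (K%:Z * x' - a'%:Z) <= K%:Z * (K.+1%:Z * x - a%:Z)) =
  (x' + (a' < a)%N%:Z <= x).
Proof.
move=> K0 aK a'K; have [d ->] : exists d, x = x' + d by exists (x - x'); lia.
rewrite lerD2l.
have -> : (K.+1%:Z * (K%:Z * x' - a'%:Z) <= K%:Z * (K.+1%:Z * (x' + d) - a%:Z)) =
    (K%:Z * a%:Z <= K.+1%:Z * a'%:Z + K%:Z * K.+1%:Z * d) by lia.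
(* For d = 0, a' < K makes K a <= (K+1) a' equivalent to a <= a'; for d >= 1 the inequality holds
   since a <= K, and for d < 0 it fails since a' < K. *)
by apply/idP/idP; case: (ltnP a' a) => h; nia.
Qed.

(** * Lecture hall partitions as integer sequences *)

(** Nonnegativity spreads from index N-1 to all smaller ones, and F is then weakly decreasing; the
    partition is F cut at its first zero. *)
Lemma lecture_hall_seq N (F : nat -> int) : (0 < N)%N ->
  (forall L, (N <= L)%N -> F L = 0) -> 0 <= F N.-1 ->
  (forall L, (L.+1 < N)%N -> (N - L)%N%:Z * F L.+1 <= (N - L.+1)%N%:Z * F L) ->
  (pad @` lecture_hall N) F.
Proof.
move=> N0 Fout Flast Fstep.
have F_ge0 L : 0 <= F L.
  have [LN|/Fout->//] := ltnP L N.
  have [d] : exists d, (d + L)%N = N.-1 by exists (N.-1 - L)%N; lia.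
  elim: d L LN => [|d IH] L LN dL; first by rewrite (_ : L = N.-1).
  have := Fstep L ltac:(lia); have := IH L.+1 ltac:(lia) ltac:(lia).
  have [K eK] : exists K, (N - L.+1)%N = K.+1 by exists (N - L.+2)%N; lia.
  have -> : (N - L)%N = K.+2 by lia.
  by rewrite eK; nia.
pose f L := absz (F L).
have Ff L : F L = (f L)%:Z by rewrite /f gez0_abs.
have fstep L : (L.+1 < N)%N -> ((N - L) * f L.+1 <= (N - L.+1) * f L)%N.
  by move=> /Fstep; rewrite !Ff -!PoszM lez_nat.
have fmono L : (f L.+1 <= f L)%N.
  have [LN|NL] := ltnP L.+1 N; last by rewrite /f Fout.
  have := fstep _ LN.
  have [K eK] : exists K, (N - L.+1)%N = K.+1 by exists (N - L.+2)%N; lia.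
  have -> : (N - L)%N = K.+2 by lia.
  by rewrite eK; nia.
have fz : exists L, f L == 0%N by exists N; rewrite /f Fout.
case: (ex_minnP fz) => n /eqP fn n_min.
have f0 L : (n <= L)%N -> f L = 0%N.
  elim: L => [|L IH]; first by rewrite leqn0 => /eqP n0; rewrite -[RHS]fn n0.
  rewrite leq_eqVlt => /orP[/eqP <- //|]; rewrite ltnS => /IH fL.
  by have := fmono L; rewrite fL; lia.
have nth_f L : nth 0%N (mkseq f n) L = f L.
  by have [h|h] := ltnP L n; [rewrite nth_mkseq | rewrite nth_default ?size_mkseq ?f0].
have nN : (n <= N)%N by apply: n_min; rewrite /f Fout.
exists (mkseq f n); last by apply/funext => L; rewrite /pad nth_f Ff.
split; rewrite ?size_mkseq //; last first.
  move=> i i_n; rewrite !nth_f.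
  have := fstep i ltac:(lia).
  rewrite ler_pdivlMr ?ltr0n; last lia.
  rewrite mulrAC ler_pdivrMr ?ltr0n; last lia.
  by rewrite -!natrM ler_nat; lia.
apply/andP; split.
  by apply/(sortedP 0%N) => i _; rewrite !nth_f; exact: fmono.
apply/(all_nthP 0%N) => i; rewrite size_mkseq nth_f => i_n.
by rewrite lt0n; apply/negP => /n_min; lia.
Qed.

Lemma lecture_hall_nth N mu L : lecture_hall N mu -> (L.+1 < N)%N ->
  ((N - L) * nth 0 mu L.+1 <= (N - L.+1) * nth 0 mu L)%N.
Proof.
move=> [_ sz lh] LN; have [h|h] := ltnP L.+1 (size mu); last first.
  by rewrite (nth_default 0%N h) muln0.
have := lh _ h; rewrite ler_pdivlMr ?ltr0n; last lia.
rewrite mulrAC ler_pdivrMr ?ltr0n; last lia.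
by rewrite -!natrM ler_nat => ?; lia.
Qed.

(** * Image, injectivity and surjectivity of Phi_N *)

Lemma Phi_row_parts_out N m L : (N <= L)%N -> Phi N (row_parts N m N) L = 0.
Proof.
move=> NL; rewrite Phi_row_parts (eqP NL) mul0r sub0r /defect.
have [bI _ _] := row_cell_array N m.
have := odd_double_half L; have := uphalf_half L => e1 e2.
have [h|h] := leqP (uphalf L) N; last by rewrite (eqP (ltnW h)) row_cnt0.
by have := bI (N - uphalf L)%N L./2 ltac:(lia); lia.
Qed.

Lemma Phi_lecture_hall N la : (0 < N)%N -> odd_partitions N la ->
  (pad @` lecture_hall N) (Phi N la).
Proof.
move=> N0 /odd_partition_rows ->; move: (fun t => _) => m {la}.
have arr := row_cell_array N m.
have step L : (L < N)%N -> ratio_ceil N (row_flow N m) L.+1 +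
    (defect N (row_cnt N m) L.+1 < defect N (row_cnt N m) L)%N%:Z <=
    ratio_ceil N (row_flow N m) L.
  move: L; apply: even_odd_cases => j jN; last first.
    have [h|h] := ltnP (2 * j).+1 N; last lia.
    by rewrite (ratio_ceil_odd arr) //; lia.
  (* For L = 2j the cell (N-1-j, j) reads a + K r = a' + (K+1) r' with a = u_(2j+1) and a' = u_(2j),
     both at most K, whence r - r' >= [a < a']. *)
  rewrite ratio_ceil_even // lerD2l.
  have [_ _ cell] := arr.
  have [jt|jt] := leqP j (N - j.+1); last lia.
  have := cell (N - j.+1)%N j jt ltac:(lia).
  have := defect_lt arr jN; rewrite /defect.
  have -> : uphalf (2 * j) = j by lia.
  have -> : uphalf (2 * j).+1 = j.+1 by lia.
  have -> : (2 * j)./2 = j by lia.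
  have -> : (2 * j).+1./2 = j by lia.
  have -> : ((N - j.+1).+1 = N - j)%N by lia.
  have b : (row_cnt N m (N - j.+1) j <= (N - j.+1 - j))%N.
    by have [bI _ _] := arr; have := bI (N - j.+1)%N j ltac:(lia); lia.
  have [K eK] : exists K, (N - j.+1 - j)%N = K by eexists.
  have -> : (N - j - j)%N = K.+1 by lia.
  have -> : (N - 2 * j)%N = K.+1 by lia.
  rewrite eK in b *; move: b.
  move: (row_cnt N m _ _) (row_cnt N m _ _) (row_flow _ _ _ _) (row_flow _ _ _ _).
  by move=> a a' r r' bK aK e; case: (ltnP a a') => h; nia.
apply: lecture_hall_seq => //; first by move=> L /Phi_row_parts_out ->.
  rewrite Phi_row_parts; have := step N.-1 ltac:(lia).
  rewrite prednK // (ratio_ceil_width arr) (defect_width arr).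
  have := defect_lt arr (L := N.-1) ltac:(lia).
  have -> : (N - N.-1)%N = 1%N by lia.
  lia.
move=> L LN; rewrite !Phi_row_parts.
have [K eK] : exists K, (N - L.+1)%N = K by eexists.
have eK1 : (N - L)%N = K.+1 by lia.
rewrite eK eK1 lecture_hall_step; [exact: step (ltnW LN)|lia| |].
  by have := defect_lt arr (ltnW LN); lia.
by have := defect_lt arr LN; lia.
Qed.

Lemma Phi_injective N : set_inj (odd_partitions N) (Phi N).
Proof.
move=> la la' /set_mem /odd_partition_rows -> /set_mem /odd_partition_rows ->.
move: (fun t => _) (fun t => _) => m m' {la la'} eqPhi.
have arr := row_cell_array N m; have arr' := row_cell_array N m'.
(* As 0 <= u_L < N-L, the value (N-L) x_L - u_L determines both x_L and u_L. *)
have out L : (L < N)%N -> defect N (row_cnt N m) L = defect N (row_cnt N m') L /\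
    ratio_ceil N (row_flow N m) L = ratio_ceil N (row_flow N m') L.
  move=> LN; have := congr1 (@^~ L) eqPhi; rewrite /= !Phi_row_parts.
  have := defect_lt arr LN; have := defect_lt arr' LN.
  move: (N - L)%N (defect _ _ _) (defect _ _ _) (ratio_ceil _ _ _) (ratio_ceil _ _ _).
  move=> K a a' x x' a'K aK e; have xx' : x = x' by nia.
  by move: e; rewrite xx'; lia.
have eqm t : (t < N)%N -> m t = m' t.
  move=> tN; rewrite -[m t](flow0 N m t) -[m' t](flow0 N m' t).
  by apply: (cell_array_backward arr arr') tN => L /out[].
congr flatten; apply/eq_in_map => t; rewrite mem_iota => tN.
by rewrite eqm.
Qed.

Lemma Phi_surjective N : set_surj (odd_partitions N) (pad @` lecture_hall N) (Phi N).
Proof.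
move=> _ [mu lh_mu <-].
(* x L is the ceiling of mu_L / (N-L), hence the shift by N-L-1, and u L is the excess of (N-L) x_L
   over mu_L. *)
pose x L := (if (L < N)%N then (nth 0%N mu L + (N - L.+1)) %/ (N - L) else 0)%N.
pose u L := ((N - L) * x L - nth 0 mu L)%N.
have muE L : (L < N)%N -> (nth 0 mu L + u L = (N - L) * x L)%N /\ (u L < N - L)%N.
  move=> LN; rewrite /u /x LN.
  have := divn_eq (nth 0 mu L + (N - L.+1))%N (N - L).
  have := @ltn_pmod (nth 0 mu L + (N - L.+1))%N (N - L) ltac:(lia).
  by move: (_ %/ _)%N (_ %% _)%N => q r; lia.
have x_out L : (N <= L)%N -> x L = 0%N by rewrite /x leqNgt => /negbTE ->.
have u_out L : (N <= L)%N -> u L = 0%N by move=> /x_out xL; rewrite /u xL muln0.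
have x_step L : (L < N)%N -> (x L.+1)%:Z + (u L.+1 < u L)%N%:Z <= (x L)%:Z.
  move=> LN; have [LN1|] := ltnP L.+1 N; last first.
    move=> h; rewrite x_out // u_out // add0r; have [] := muE L LN; lia.
  have [e1 u1] := muE L LN; have [e2 u2] := muE _ LN1.
  have := lecture_hall_nth lh_mu LN1.
  have [K eK] : exists K, (N - L.+1)%N = K by eexists.
  have eK1 : (N - L)%N = K.+1 by lia.
  rewrite eK eK1 in e1 e2 u1 u2 *.
  rewrite -(@lecture_hall_step K); [|lia..].
  have -> : K%:Z * (x L.+1)%:Z - (u L.+1)%:Z = (nth 0%N mu L.+1)%:Z by lia.
  have -> : K.+1%:Z * (x L)%:Z - (u L)%:Z = (nth 0%N mu L)%:Z by lia.
  by rewrite -!PoszM lez_nat.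
pose R := back_R N u (fun L => (x L)%:Z); pose I := back_cnt N u (fun L => (x L)%:Z).
have u_lt L : (L < N)%N -> (u L < N - L)%N by case/muE.
have xN : (x N)%:Z = 0 by rewrite x_out.
have arr : cell_array N I R := back_cell_array u_lt u_out x_step.
(* The multiplicities are column 0 of the constructed array; forward determination identifies this
   array with the one that inserting them produces. *)
pose m t := R t 0%N; have arr' := row_cell_array N m.
have R0 t : (t < N)%N -> R t 0%N = row_flow N m t 0%N by rewrite /row_flow flow0.
have [eqI eqR] := cell_array_forward arr arr' R0.
exists (row_parts N m N).
  exact: row_parts_odd.
apply/funext => L; rewrite /pad.
have [LN|NL] := ltnP L N; last first.
  rewrite Phi_row_parts_out // nth_default //.
  by have [_ sz _] := lh_mu; exact: leq_trans sz NL.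
have [e _] := muE L LN.
have := odd_double_half L; have := uphalf_half L => h1 h2.
rewrite Phi_row_parts.
have -> : defect N (row_cnt N m) L = u L.
  rewrite -(back_defect u (fun L => (x L)%:Z) LN) /defect -eqI //; lia.
have -> : ratio_ceil N (row_flow N m) L = (x L)%:Z.
  rewrite -(back_ratio_ceil u_lt u_out x_step xN (ltnW LN)) /ratio_ceil.
  by apply: eq_bigr => t _; have := ltn_ord t; move=> ht; rewrite -!eqR //; lia.
by rewrite -PoszM -e; lia.
Qed.

Theorem mainTheorem5 (N : nat) (N_gt0 : (0 < N)%N) :
  set_bij (odd_partitions N) (pad @` lecture_hall N) (Phi N).
Proof.
split; [|exact: Phi_injective|exact: Phi_surjective].
by move=> la; exact: Phi_lecture_hall.
Qed.
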